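(* Let $p$ be a prime and $h$ a non-zero element of $\mathbb{F}_p$. Then the polynomial $X^p-X-h$ is irreducible over $\mathbb{F}_p$. Let $\xi$ be a root of $X^p-X-h$ and let $K=\mathbb{F}_p(\xi)$, so that $K$ is a finite field with $p^p$ elements. For all $(b,c)\in\mathbb{F}_p^2$ define $$f_{b,c}(X)=(X-b-\xi)^2+c+\xi\in K[X].$$ If $p\equiv 1 \pmod 4$ and $h$ is a non-square in $\mathbb{F}_p$, then the polynomials $f_{b,c}(X)$, $(b,c)\in\mathbb{F}_p^2$, form a dynamically-irreducible set over $K$.
   Context: A set of polynomials $f_1,\ldots,f_r$ of positive degree over a finite field $F$ is called dynamically-irreducible (over $F$) if all polynomials formed by composition of $f_1,\ldots,f_r$, i.e. all $f_{i_1}\circ f_{i_2}\circ\cdots\circ f_{i_n}$ with $n\ge 1$ and $i_1,\ldots,i_n\in\{1,\ldots,r\}$ (repetitions allowed), are irreducible over $F$. *)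

(* Defs.v *)
From HB Require Import structures.
From mathcomp Require Import all_boot all_order all_algebra all_field.

Set Implicit Arguments.
Unset Strict Implicit.
Unset Printing Implicit Defensive.

Import GRing.Theory.
Local Open Scope ring_scope.

(* p \Po q is p(q(X)), so the word [:: i_1; ...; i_n] is sent to
   f_{i_1} o f_{i_2} o ... o f_{i_n}, and the empty word to 'X. *)
Definition word_comp (F : fieldType) (I : finType) (f : I -> {poly F})
    (w : seq I) : {poly F} :=
  foldr (fun i g => f i \Po g) 'X w.

Definition dynamically_irreducible (F : fieldType) (I : finType)
    (f : I -> {poly F}) : Prop :=
  (forall i, 1 < size (f i))%N /\
  (forall w : seq I, w != [::] -> irreducible_poly (word_comp f w)).

Definition artin_schreier (p : nat) (h : 'F_p) : {poly 'F_p} :=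
  'X^p - 'X - h%:P.

Definition quad_fam (p : nat) (K : fieldExtType 'F_p) (xi : K)
    (bc : 'F_p * 'F_p) : {poly K} :=
  ('X - (bc.1%:A)%:P - xi%:P) ^+ 2 + (bc.2%:A)%:P + xi%:P.

(* Main.v *)
Require Import Defs.
From HB Require Import structures.
From mathcomp Require Import all_boot all_order all_algebra all_field.

Set Implicit Arguments.
Unset Strict Implicit.
Unset Printing Implicit Defensive.

Import GRing.Theory.
Local Open Scope ring_scope.

(** Capelli-type criterion: if [g] is monic and irreducible of degree [d], then
    [g((X - a)^2 + b)] is irreducible as soon as [(-1)^d g(b)] is not a square
    ([irredp_comp_quadratic]).  After translating, [a = b = 0]; if [q] is a
    nonconstant divisor of [g(X^2)], write [q(X) q(-X) = n(X^2)].  Then [n]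
    divides [g^2], so [n] is associated to [g] or to [g^2].  In the second case
    [q] has full degree.  In the first, comparing leading coefficients and
    values at [0] displays [(-1)^d g(0)] as the square of [q(0) / lead q].

    Apply this to a composition [g] of members of the family and one more member
    inside it, so that [b] above is [c + xi].  Each [f_{b,c}] maps [F_p + xi] into itself,
    so [g(c + xi) = d + xi] for some [d] in [F_p], and [-1] is a square
    because [p = 1 mod 4].  It remains to see that no [x = d + xi] is a square
    in [K].  As [x^p = x + h], the Frobenius conjugates of [x] are the
    [x + i h], hence its norm is [prod_(a in F_p) (x - a) = x^p - x = h]
    ([frob_norm_root]).  If [x] were [y^2], then [h] would be the square of the
    norm of [y], which lies in [F_p] ([artin_schreier_root_nonsquare]).

    Irreducibility of [X^p - X - h]: over a splitting field its roots are the
    [xi + a] with [a] in [F_p].  The sum of the roots of a monic divisor of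
    degree [0 < k < p] is [k xi] plus an element of [F_p], and it lies in [F_p];
    so [xi] is in [F_p], whence [xi^p = xi], contradicting [h <> 0].
    So [X^p - X - h] is the minimal polynomial of [xi], and [K] has [p^p]
    elements. *)

(** * Irreducibility under composition with a quadratic *)

Lemma dvdp_comp_polyE (F : fieldType) (r p q : {poly F}) :
  (1 < size r)%N -> (p \Po r %| q \Po r) = (p %| q).
Proof.
move=> r_gt1; apply/idP/idP; last exact: dvdp_comp_poly.
have [-> | p_neq0] := eqVneq p 0.
  by rewrite comp_poly0 !dvd0p comp_poly_eq0.
move=> p_dv_q.
have gcd_neq0 : gcdp p q != 0 by rewrite gcdp_eq0 negb_and p_neq0.
have /eqp_size gcd_comp : gcdp p q \Po r %= p \Po r.
  by apply: eqp_trans (gcdp_comp_poly r p q) _; rewrite dvdp_gcd_idl.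
have size_gcd : size (gcdp p q) == size p.
  have := congr1 predn gcd_comp; rewrite !size_comp_poly => /eqP.
  rewrite eqn_pmul2r; last by rewrite -subn1 subn_gt0.
  by move=> /eqP eq_pred; rewrite -[X in _ == X]prednK ?size_poly_gt0 //
    -eq_pred prednK ?size_poly_gt0.
rewrite (dvdp_size_eqp (dvdp_gcdl p q)) in size_gcd.
by rewrite -(eqp_dvdl q size_gcd) dvdp_gcdr.
Qed.

Lemma irredp_comp_XaddC (F : fieldType) (g : {poly F}) (c : F) :
  irreducible_poly g -> irreducible_poly (g \Po ('X + c%:P)).
Proof.
move=> [g_gt1 irr_g].
have size2 d : size ('X + d%:P : {poly F}) = 2 by rewrite size_XaddC.
have shiftK d : ('X - d%:P : {poly F}) \Po ('X + d%:P) = 'X.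
  by rewrite comp_polyB comp_polyX comp_polyC addrK.
have shiftNK : ('X + c%:P) \Po ('X - c%:P) = 'X.
  by rewrite comp_polyD comp_polyX comp_polyC subrK.
split=> [|q q_neq1 q_dv]; first by rewrite size_comp_poly2.
have q_def : q = (q \Po ('X - c%:P)) \Po ('X + c%:P).
  by rewrite -comp_polyA shiftK comp_polyXr.
rewrite -(dvdp_size_eqp q_dv) [in size q]q_def !size_comp_poly2 ?size_XsubC //.
have -> : size q = size (q \Po ('X - c%:P)).
  by rewrite size_comp_poly2 ?size_XsubC.
have dv_g : q \Po ('X - c%:P) %| g.
  by have := dvdp_comp_poly ('X - c%:P) q_dv;
    rewrite -comp_polyA shiftNK comp_polyXr.
rewrite (dvdp_size_eqp dv_g); apply: irr_g dv_g.
by rewrite size_comp_poly2 ?size_XsubC.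
Qed.

(** The norm of [q] from [F[X]] to [F[X^2]]. *)
Lemma mul_comp_polyNX (F : fieldType) (q : {poly F}) :
  q * (q \Po (- 'X)) = (even_poly q ^+ 2 - 'X * odd_poly q ^+ 2) \Po 'X^2.
Proof.
set e := even_poly q; set o := odd_poly q.
have sqrNX : 'X^2 \Po (- 'X : {poly F}) = 'X^2.
  by rewrite comp_Xn_poly sqrrN.
have -> : q \Po (- 'X) = e \Po 'X^2 - (o \Po 'X^2) * 'X.
  rewrite -{1}[q]poly_even_odd -/e -/o comp_polyD comp_polyM comp_polyX.
  by rewrite -!comp_polyA sqrNX mulrN.
rewrite -{1}[q]poly_even_odd -/e -/o mulrC -subr_sqr.
rewrite comp_polyB [('X * _) \Po _]comp_polyM comp_polyX !rmorphXn /= exprMn.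
by rewrite ['X^2 * _]mulrC.
Qed.

Lemma irredp_comp_X2 (F : fieldType) (g : {poly F}) :
    g \is monic -> irreducible_poly g ->
    (forall y, y ^+ 2 != (-1) ^+ (size g).-1 * g.[0]) ->
  irreducible_poly (g \Po 'X^2).
Proof.
move=> g_monic irr_g nsq; have [g_gt1 _] := irr_g.
have g_neq0 := irredp_neq0 irr_g.
have X2_gt1 : (1 < size ('X^2 : {poly F}))%N by rewrite size_polyXn.
have size_gX2 : (size (g \Po 'X^2)).-1 = ((size g).-1 * 2)%N.
  by rewrite size_comp_poly size_polyXn.
have gX2_neq0 : g \Po 'X^2 != 0 by rewrite comp_poly_eq0.
split=> [|q q_neq1 q_dv].
  by rewrite -subn_gt0 subn1 size_gX2 muln_gt0 -subn1 subn_gt0 g_gt1.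
have q_neq0 : q != 0.
  by apply: contraNneq gX2_neq0 => q0; rewrite q0 dvd0p in q_dv.
pose n := even_poly q ^+ 2 - 'X * odd_poly q ^+ 2.
have nE : q * (q \Po - 'X) = n \Po 'X^2 by apply: mul_comp_polyNX.
have sizeNX : size (- 'X : {poly F}) = 2 by rewrite size_polyN size_polyX.
have size_qN : size (q \Po - 'X) = size q by rewrite size_comp_poly2.
have qN_neq0 : q \Po - 'X != 0 by rewrite comp_poly2_eq0.
have n_neq0 : n != 0.
  by rewrite -(comp_poly_eq0 _ X2_gt1) -nE mulf_neq0.
have size_n : size n = size q.
  have := congr1 (predn \o (fun r : {poly F} => size r)) nE.
  rewrite /= size_comp_poly size_polyXn size_mul // size_qN.
  rewrite -[size q](prednK (_ : 0 < _)%N) ?size_poly_gt0 //.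
  rewrite addSn addnS /= addnn -muln2.
  move/eqP; rewrite eqn_pmul2r // => /eqP ->.
  by rewrite prednK ?size_poly_gt0.
have n_dv : n %| g * g.
  rewrite -(dvdp_comp_polyE _ _ X2_gt1) -nE comp_polyM dvdp_mul //.
  have -> : g \Po 'X^2 = (g \Po 'X^2) \Po (- 'X).
    by rewrite -comp_polyA comp_Xn_poly sqrrN.
  exact: dvdp_comp_poly.
have n_neq1 : ~~ (n %= 1) by rewrite -size_poly_eq1 size_n.
(* If [n] is associated to [g^2], then [q] has the degree of [g(X^2)]. *)
have sq_case : n %= g * g -> q %= g \Po 'X^2.
  move=> /eqp_size; rewrite size_n size_mul // => size_q.
  rewrite -(dvdp_size_eqp q_dv) size_q.
  rewrite -[size (_ \Po _)]prednK ?size_poly_gt0 // size_gX2.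
  rewrite -[size g](prednK (_ : 0 < _)%N) ?size_poly_gt0 //.
  by rewrite addSn addnS /= addnn muln2.
have [gcd1 | gcd_g] := irredp_XsubCP irr_g (dvdp_gcdr n g).
  have cop : coprimep n g by rewrite /coprimep size_poly_eq1.
  rewrite -size_poly_eq1 -dvdp1 -(Gauss_dvdpl _ cop) mul1r in n_neq1.
  by rewrite -(Gauss_dvdpl _ cop) n_dv in n_neq1.
have /dvdpP [s n_def] : g %| n by rewrite -(eqp_dvdl n gcd_g) dvdp_gcdl.
have s_dv : s %| g by rewrite -(dvdp_mul2r s g g_neq0) -n_def.
(* [s] constant means that [n] is associated to [g]. *)
have [s1 | s_g] := irredp_XsubCP irr_g s_dv; last first.
  by apply: sq_case; rewrite n_def eqp_mulr.
have /size_poly1P [k k_neq0 s_k] : size s == 1%N by rewrite size_poly_eq1.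
case/negP: (nsq (q.[0] / lead_coef q)); apply/eqP.
have lead_q : (-1) ^+ (size q).-1 * lead_coef q ^+ 2 = k.
  have := congr1 lead_coef nE.
  rewrite lead_coefM !lead_coef_comp ?sizeNX // lead_coefN lead_coefX.
  rewrite lead_coefXn expr1n mulr1 n_def s_k lead_coefM.
  rewrite lead_coefC (monicP g_monic) mulr1 => <-.
  by rewrite mulrA -expr2 mulrC.
have size_q : size q = size g.
  by rewrite -size_n n_def s_k mul_polyC size_scale.
have eval0 : q.[0] ^+ 2 = k * g.[0].
  have := congr1 (horner^~ 0) nE.
  by rewrite /= n_def s_k hornerM !horner_comp !hornerE oppr0 expr0n.
rewrite expr_div_n eval0 -lead_q size_q mulrAC mulfK //.
by rewrite expf_neq0 // lead_coef_eq0.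
Qed.

Lemma irredp_comp_quadratic (F : fieldType) (g : {poly F}) (a b : F) :
    g \is monic -> irreducible_poly g ->
    (forall y, y ^+ 2 != (-1) ^+ (size g).-1 * g.[b]) ->
  irreducible_poly (g \Po (('X - a%:P) ^+ 2 + b%:P)).
Proof.
move=> g_monic irr_g nsq.
have -> : g \Po (('X - a%:P) ^+ 2 + b%:P)
    = ((g \Po ('X + b%:P)) \Po 'X^2) \Po ('X + (- a)%:P).
  rewrite -!comp_polyA comp_polyD comp_polyX comp_polyC.
  by rewrite comp_Xn_poly polyCN.
apply/irredp_comp_XaddC/irredp_comp_X2; last 1 first.
- move=> y; rewrite size_comp_poly2 ?size_XaddC // horner_comp.
  by rewrite !hornerE; apply: nsq.
- rewrite monicE lead_coef_comp ?size_XaddC // lead_coefXaddC expr1n mulr1.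
  exact: g_monic.
exact: irredp_comp_XaddC.
Qed.

(** * The Artin-Schreier polynomial *)

Lemma exprD_Fp_pn (p : nat) (p_prime : prime p) (L : fieldExtType 'F_p)
    (x y : L) n :
  (x + y) ^+ (p ^ n) = x ^+ (p ^ n) + y ^+ (p ^ n).
Proof.
by apply: exprDn_pchar; rewrite pnatX pnatE // pchar_lalg pchar_Fp.
Qed.

Lemma expr_Fp_pn (p : nat) (p_prime : prime p) (a : 'F_p) n : a ^+ (p ^ n) = a.
Proof.
elim: n => [|n IHn]; first by rewrite expr1.
by rewrite expnSr exprM IHn; have := expf_card a; rewrite (card_Fp p_prime).
Qed.

Lemma prod_sub_Fp (p : nat) (p_prime : prime p) (L : fieldExtType 'F_p)
    (x : L) :
  \prod_(a : 'F_p) (x - a%:A) = x ^+ p - x.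
Proof.
have /(congr1 (fun q => (map_poly (in_alg L) q).[x])) := finField_genPoly 'F_p.
rewrite rmorphB /= map_polyXn map_polyX !hornerE (card_Fp p_prime) => ->.
rewrite rmorph_prod horner_prod; apply: eq_bigr => a _.
by rewrite /= map_polyXsubC !hornerE.
Qed.

Lemma map_artin_schreier (p : nat) (h : 'F_p) (L : fieldExtType 'F_p) :
  map_poly (in_alg L) (artin_schreier h) = 'X^p - 'X - (h%:A)%:P.
Proof. by rewrite !rmorphB /= map_polyXn map_polyX map_polyC. Qed.

Lemma root_artin_schreier (p : nat) (h : 'F_p) (L : fieldExtType 'F_p)
    (xi : L) :
  root (map_poly (in_alg L) (artin_schreier h)) xi = (xi ^+ p == xi + h%:A).
Proof.
by rewrite map_artin_schreier rootE !hornerE subr_eq0 subr_eq addrC.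
Qed.

Lemma size_artin_schreier (p : nat) (p_prime : prime p) (h : 'F_p) :
  size (artin_schreier h) = p.+1.
Proof.
rewrite /artin_schreier -addrA -opprD size_polyDl size_polyXn //.
by rewrite size_polyN size_XaddC ltnS prime_gt1.
Qed.

(** The roots of [X^p - X - h] are the translates [xi + a] of any one of them:
    substitute [X - xi] in [X^p - X = prod_a (X - a)]. *)
Lemma map_artin_schreier_prod (p : nat) (p_prime : prime p) (h : 'F_p)
    (L : fieldExtType 'F_p) (xi : L) :
    root (map_poly (in_alg L) (artin_schreier h)) xi ->
  map_poly (in_alg L) (artin_schreier h)
    = \prod_(a : 'F_p) ('X - (xi + a%:A)%:P).
Proof.
rewrite root_artin_schreier map_artin_schreier => /eqP xi_root.
have charL : p \in [pchar {poly L}].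
  by rewrite pchar_poly pchar_lalg pchar_Fp.
have /(congr1 (fun q => (map_poly (in_alg L) q) \Po ('X - xi%:P))) :=
  finField_genPoly 'F_p.
rewrite rmorphB /= map_polyXn map_polyX comp_polyB comp_Xn_poly comp_polyX.
rewrite (card_Fp p_prime) -(pFrobenius_autE charL) rmorphB /= !pFrobenius_autE.
rewrite -rmorphXn /= xi_root => prodE.
transitivity ('X^p - (xi + h%:A)%:P - ('X - xi%:P)).
  rewrite -!addrA; congr (_ + _).
  by rewrite polyCD opprD opprB addrACA addNr add0r addrC.
rewrite prodE rmorph_prod /= rmorph_prod /=; apply: eq_bigr => a _.
by rewrite map_polyXsubC comp_polyB comp_polyX comp_polyC polyCD opprD addrA.
Qed.

Lemma artin_schreier_irr (p : nat) (p_prime : prime p) (h : 'F_p) :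
  h != 0 -> irreducible_poly (artin_schreier h).
Proof.
move=> h_neq0; pose f := artin_schreier h.
have size_f : size f = p.+1 := size_artin_schreier p_prime h.
have f_neq0 : f != 0 by rewrite -size_poly_eq0 size_f.
have p_gt0 := prime_gt0 p_prime.
split=> [|q q_neq1 q_dv]; first by rewrite size_f ltnS.
have [L [rs f_rs _]] := FinSplittingFieldFor f_neq0.
have [xi xi_root] : exists xi : L, root (map_poly (in_alg L) f) xi.
  case: rs f_rs => [|xi rs] f_rs.
    move/eqp_size: f_rs; rewrite size_map_poly size_f big_nil size_poly1.
    by move=> -[p0]; rewrite p0 in p_gt0.
  by exists xi; rewrite (eqp_root f_rs) root_prod_XsubC mem_head.
have f_prod := map_artin_schreier_prod p_prime xi_root.
have q_neq0 : q != 0.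
  by apply: contraNneq f_neq0 => q0; rewrite q0 dvd0p in q_dv.
have q_monic' : exists2 q' : {poly 'F_p}, q' \is monic & q' %= q.
  exists ((lead_coef q)^-1 *: q); last first.
    by rewrite eqp_scale // invr_eq0 lead_coef_eq0.
  by rewrite monicE lead_coefZ mulVf // lead_coef_eq0.
have {q_monic'} [q' q'_monic q'_q] := q_monic'.
rewrite -(eqp_ltrans q'_q) -(eqp_dvdl _ q'_q) in q_dv *.
rewrite -(eqp_size q'_q) in q_neq1.
have : map_poly (in_alg L) q' %| map_poly (in_alg L) f by rewrite dvdp_map.
rewrite f_prod -big_enum => /dvdp_prod_XsubC [m].
set s := mask m _.
rewrite eqp_monic ?monic_prod_XsubC ?monic_map // => /eqP q'_def.
have size_s : size q' = (size s).+1.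
  by rewrite -(size_map_poly (in_alg L)) q'_def size_prod_XsubC.
have s_gt0 : (0 < size s)%N by rewrite lt0n -eqSS -size_s.
have s_le : (size s <= p)%N by rewrite -ltnS -size_s -size_f dvdp_leq.
rewrite -(dvdp_size_eqp q_dv) size_s size_f eqSS eqn_leq s_le /= leqNgt.
apply/negP=> s_lt.
(* The subleading coefficient of [q'] is minus the sum of its roots. *)
have : (map_poly (in_alg L) q')`_(size s).-1 = - \sum_(a <- s) (xi + a%:A).
  rewrite q'_def -(big_map (fun a => xi + a%:A) xpredT (fun z => 'X - z%:P)).
  rewrite -(size_map (fun a => xi + a%:A) s) coefPn_prod_XsubC ?big_map //.
  by rewrite size_map -lt0n.
rewrite coef_map /= big_split /= -scaler_suml => coef_eq.
have s_unit : ((size s)%:R : 'F_p) != 0.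
  rewrite -(dvdn_pcharf (pchar_Fp p_prime)); apply/negP=> /dvdn_leq.
  by rewrite s_gt0 leqNgt s_lt => /(_ isT).
have [c xi_c] : exists c : 'F_p, xi = c%:A.
  exists ((size s)%:R^-1 * (- (q'`_(size s).-1) - \sum_(a <- s) a)).
  rewrite -scalerA; apply: (canRL (scalerK s_unit)).
  rewrite scalerBl scaleNr coef_eq opprK addrK.
  by rewrite big_const_seq count_predT iter_addr_0 scaler_nat.
move: xi_root; rewrite root_artin_schreier xi_c -in_algE -rmorphXn.
have := expr_Fp_pn p_prime c 1; rewrite expn1 => ->.
rewrite -subr_eq0 opprD addrA subrr add0r oppr_eq0 scaler_eq0 oner_eq0.
by rewrite (negPf h_neq0).
Qed.

Lemma card_artin_schreier_ext (p : nat) (p_prime : prime p) (h : 'F_p) :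
    h != 0 -> forall (K : fieldExtType 'F_p) (xi : K),
    root (map_poly (in_alg K) (artin_schreier h)) xi ->
    <<1; xi>>%VS = {:K}%VS ->
  #|finvect_type K| = (p ^ p)%N.
Proof.
move=> h_neq0 K xi xi_root K_gen.
have [q minE] := polyOver1P (minPolyOver 1 xi).
have q_dv : q %| artin_schreier h.
  by rewrite -(dvdp_map (in_alg K)) -minE minPoly_dvdp // alg_polyOver.
have [_ irr] := artin_schreier_irr p_prime h_neq0.
have size_q : size q = (adjoin_degree 1 xi).+1.
  by rewrite -size_minPoly minE size_map_poly.
have q_neq1 : size q != 1 by rewrite size_q.
have := eqp_size (irr q q_neq1 q_dv).
rewrite size_q size_artin_schreier // => -[deg_xi].
have dimK : \dim {:K} = p.
  by rewrite -K_gen dim_Fadjoin deg_xi dimv1 muln1.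
rewrite -(@card_vspacef 'F_p (finvect_type K) (Vector.class (finvect_type K))).
by rewrite card_vspace card_Fp // -[X in (_ ^ X)%N]/(\dim {:K}) dimK.
Qed.

(** * The norm to the prime field *)

Lemma sqrtN1_Fp (p : nat) (p_prime : prime p) :
  (p %% 4 = 1)%N -> exists i : 'F_p, i ^+ 2 = -1.
Proof.
move=> p_mod4; pose m := (p %/ 4)%N.
have p_eq : p = (4 * m).+1 by rewrite {1}(divn_eq p 4) p_mod4 addn1 mulnC.
have m_gt0 : (0 < m)%N.
  by rewrite lt0n; apply/eqP=> m0; move: (prime_gt1 p_prime); rewrite p_eq m0.
(* [X^(2m) - 1] cannot vanish at all the [4m] nonzero elements of [F_p]. *)
have [x /andP [x_neq0 xm]] : exists x : 'F_p, (x != 0) && (x ^+ (2 * m) != 1).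
  apply/existsP; apply: contraT; rewrite negb_exists => /forallP all1.
  have : all (root ('X^(2 * m) - 1%:P : {poly 'F_p}))
             (enum (predC1 (0 : 'F_p))).
    apply/allP=> x; rewrite mem_enum inE => x_neq0.
    have := all1 x; rewrite x_neq0 negbK => /eqP xm.
    by rewrite rootE !hornerE xm subrr.
  have X_neq0 : 'X^(2 * m) - 1%:P != 0 :> {poly 'F_p}.
    by rewrite -size_poly_eq0 size_XnsubC // muln_gt0.
  move/(max_poly_roots X_neq0)/(_ (enum_uniq _)).
  rewrite -cardE cardC1 card_Fp // size_XnsubC ?muln_gt0 // {1}p_eq /= ltnS.
  by rewrite leq_pmul2r.
exists (x ^+ m); rewrite -exprM mulnC; apply/eqP.
have : (x ^+ (2 * m)) ^+ 2 == 1.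
  have xp : x ^+ (4 * m).+1 = x.
    by rewrite -(congr1 (GRing.exp x) p_eq) -[p in x ^+ p]expn1 expr_Fp_pn.
  apply/eqP/(mulfI x_neq0).
  by rewrite mulr1 -exprM mulnAC -exprS.
by rewrite sqrf_eq1 (negPf xm).
Qed.

(** The product of the first [p] iterated Frobenius images of [y].  When [K] has
    degree [p] over [F_p], this is the norm from [K] to [F_p], viewed in [K]. *)
Definition frob_norm (p : nat) (K : fieldExtType 'F_p) (y : K) : K :=
  \prod_(i < p) y ^+ (p ^ i).

Lemma frob_normM (p : nat) (K : fieldExtType 'F_p) (x y : K) :
  frob_norm (x * y) = frob_norm x * frob_norm y.
Proof. by rewrite -big_split; apply: eq_bigr => i _; rewrite exprMn. Qed.

Lemma frob_norm_Fp (p : nat) (p_prime : prime p) (K : fieldExtType 'F_p)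
    (y : K) :
  y ^+ (p ^ p) = y -> exists a : 'F_p, frob_norm y = a%:A.
Proof.
move=> y_p; have p_gt0 := prime_gt0 p_prime.
have : frob_norm y ^+ p - frob_norm y == 0.
  rewrite subr_eq0 /frob_norm -prodrXl.
  under eq_bigr do rewrite -exprM -expnSr.
  suff shift n : (0 < n)%N -> y ^+ (p ^ n) = y ->
      \prod_(i < n) y ^+ (p ^ i.+1) = \prod_(i < n) y ^+ (p ^ i).
    by apply/eqP/shift.
  case: n => // n _ yn.
  by rewrite big_ord_recr big_ord_recl /= yn mulrC expr1.
(* A root of [x^p - x = prod_a (x - a)] is one of the [a] in [F_p]. *)
rewrite -prod_sub_Fp // => /prodf_eq0 [a _]; rewrite subr_eq0 => /eqP ->.
by exists a.
Qed.

(** The Frobenius conjugates of [x] are the [x + i h], that is, all the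
    translates [x - a] by elements [a] of [F_p]. *)
Lemma frob_norm_root (p : nat) (p_prime : prime p) (h : 'F_p)
    (K : fieldExtType 'F_p) (x : K) :
  h != 0 -> x ^+ p = x + h%:A -> frob_norm x = h%:A.
Proof.
move=> h_neq0 x_p.
have xpi i : x ^+ (p ^ i) = x - (- (i%:R * h))%:A.
  elim: i => [|i IHi]; first by rewrite expr1 mul0r oppr0 scale0r subr0.
  rewrite expnS exprM x_p -in_algE exprD_Fp_pn // IHi -rmorphXn /=.
  rewrite expr_Fp_pn //.
  by rewrite !scaleNr !opprK -addrA -scalerDl -natr1 mulrDl mul1r.
rewrite /frob_norm; under eq_bigr do rewrite xpi.
pose t (i : 'I_p) : 'F_p := - (i%:R * h).
have t_inj : injective t.
  move=> i j /oppr_inj /(mulIf h_neq0) /(congr1 val) /=.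
  by rewrite !val_Fp_nat // !modn_small // => /val_inj.
have t_bij : bijective t.
  by apply: inj_card_bij => //; rewrite card_Fp // card_ord.
transitivity (\prod_(a : 'F_p) (x - a%:A)).
  by rewrite (reindex t) //; apply: onW_bij.
by rewrite prod_sub_Fp // x_p addrC addKr.
Qed.

Lemma artin_schreier_root_nonsquare (p : nat) (p_prime : prime p) (h : 'F_p)
    (K : fieldExtType 'F_p) (x y : K) :
    h != 0 -> ~ (exists z : 'F_p, z ^+ 2 = h) ->
    x ^+ p = x + h%:A -> y ^+ (p ^ p) = y ->
  y ^+ 2 != x.
Proof.
move=> h_neq0 h_nsq x_p y_p; apply/eqP=> y_x.
have [z Ny] := frob_norm_Fp p_prime y_p.
case: h_nsq; exists z; apply: (fmorph_inj (in_alg K)).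
rewrite rmorphXn /= -Ny -(frob_norm_root p_prime h_neq0 x_p) -y_x.
by rewrite expr2 -frob_normM.
Qed.

(** * The quadratic family *)

Lemma quad_famE (p : nat) (K : fieldExtType 'F_p) (xi : K) bc :
  quad_fam xi bc = ('X - (bc.1%:A + xi)%:P) ^+ 2 + (bc.2%:A + xi)%:P.
Proof. by rewrite /quad_fam !polyCD opprD !addrA. Qed.

Lemma quad_fam_monic (p : nat) (K : fieldExtType 'F_p) (xi : K) bc :
  (quad_fam xi bc \is monic) /\ size (quad_fam xi bc) = 3.
Proof.
rewrite quad_famE; set a := _ + xi; set b := (bc.2%:A + xi)%:P.
have size_sq : size (('X - a%:P) ^+ 2) = 3 by rewrite size_exp_XsubC.
have size_lt : (size b < size (('X - a%:P) ^+ 2))%N.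
  by rewrite size_sq size_polyC; case: (_ != 0).
split; last by rewrite size_polyDl // size_sq.
by rewrite monicE lead_coefDl // -monicE monic_exp // monicXsubC.
Qed.

Lemma word_comp_rcons (F : fieldType) (I : finType) (f : I -> {poly F}) w i :
  word_comp f (rcons w i) = word_comp f w \Po f i.
Proof.
elim: w => [|j w IHw] /=; first by rewrite comp_polyX comp_polyXr.
by rewrite IHw comp_polyA.
Qed.

(** Compositions of the family map the translate [F_p + xi] into itself. *)
Lemma word_comp_quad_fam_eval (p : nat) (K : fieldExtType 'F_p) (xi : K)
    w (c : 'F_p) :
  exists d : 'F_p,
    (word_comp (quad_fam xi) w).[c%:A + xi] = d%:A + xi.
Proof.
elim: w => [|bc w [d IHw]] /=; first by exists c; rewrite hornerX.
exists ((d - bc.1) ^+ 2 + bc.2).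
rewrite horner_comp IHw quad_famE hornerD horner_exp hornerXsubC hornerC.
rewrite opprD addrACA subrr addr0 addrA.
by rewrite -!in_algE -rmorphB -rmorphXn -rmorphD.
Qed.

Lemma quad_fam_dynamically_irreducible (p : nat) (p_prime : prime p) (h : 'F_p)
    (K : fieldExtType 'F_p) (xi : K) :
    h != 0 -> ~ (exists y : 'F_p, y ^+ 2 = h) -> (p %% 4 = 1)%N ->
    xi ^+ p = xi + h%:A -> (forall y : K, y ^+ (p ^ p) = y) ->
  dynamically_irreducible (quad_fam xi).
Proof.
move=> h_neq0 h_nsq p_mod4 xi_p frobK.
have [i iE] := sqrtN1_Fp p_prime p_mod4.
split=> [bc|w _]; first by have [_ ->] := quad_fam_monic xi bc.
suff [] : word_comp (quad_fam xi) w \is monic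
    /\ irreducible_poly (word_comp (quad_fam xi) w) by [].
elim/last_ind: w => [|w bc [w_monic w_irr]].
  rewrite /word_comp /= -['X]subr0 -polyC0 monicXsubC.
  by split; last exact: irredp_XsubC.
rewrite word_comp_rcons; split.
  have [f_monic f_size] := quad_fam_monic xi bc.
  by rewrite monicE lead_coef_comp ?f_size // (monicP f_monic) expr1n mulr1.
rewrite quad_famE; apply: irredp_comp_quadratic => // y.
have [d ->] := word_comp_quad_fam_eval xi w bc.2.
set n := (size _).-1; apply/eqP=> y_sq.
have x_p : (d%:A + xi) ^+ p = (d%:A + xi) + h%:A.
  rewrite -[p in _ ^+ p]expn1 exprD_Fp_pn // expn1 xi_p -in_algE -rmorphXn /=.
  by rewrite -[p in d ^+ p]expn1 expr_Fp_pn // addrA.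
(* [y^2 = (-1)^n x] gives [(i^n y)^2 = x]. *)
case/eqP: (artin_schreier_root_nonsquare p_prime h_neq0 h_nsq x_p
  (frobK ((i ^+ n)%:A * y))).
rewrite exprMn y_sq mulrA -in_algE -rmorphXn /= -exprM mulnC exprM iE.
by rewrite -in_algE rmorphXn rmorphN1 -exprMn mulrNN mulr1 expr1n mul1r.
Qed.

Theorem theorem1 (p : nat) (p_prime : prime p) (h : 'F_p) (h_neq0 : h != 0) :
  irreducible_poly (artin_schreier h) /\
  (forall (K : fieldExtType 'F_p) (xi : K),
     root (map_poly (in_alg K) (artin_schreier h)) xi ->
     <<1; xi>>%VS = {:K}%VS ->
     #|finvect_type K| = (p ^ p)%N /\
     ((p %% 4 = 1)%N ->
      ~ (exists y : 'F_p, y ^+ 2 = h) ->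
      dynamically_irreducible (quad_fam xi))).
Proof.
split=> [|K xi xi_root K_gen]; first exact: artin_schreier_irr.
have cardK := card_artin_schreier_ext p_prime h_neq0 xi_root K_gen.
split=> // p_mod4 h_nsq.
apply: quad_fam_dynamically_irreducible h_neq0 h_nsq p_mod4 _ _ => //.
  by apply/eqP; rewrite -root_artin_schreier.
by move=> y; rewrite -cardK; apply: (expf_card (y : finvect_type K)).
Qed.
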